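(* Let $L$ be a compactly generated multiplicative lattice in which the top element $1$ is compact and every finite product of compact elements is compact, and suppose $L$ is a $szi$-multiplicative lattice. An element $r\in L$ is $z$-primary if and only if $r$ is a $z$-element and $r$ is a primary element of $L$.
   Context: A multiplicative lattice is a complete lattice $(L,\leqslant,0,1)$ endowed with an associative, commutative multiplication which distributes over arbitrary joins and has $1$ as multiplicative identity. An element $c\in L$ is compact if for any $\{x_\lambda\}_{\lambda\in\Lambda}\subseteq L$, $c\leqslant\bigvee_{\lambda\in\Lambda}x_\lambda$ implies $c\leqslant\bigvee_{i=1}^n x_{\lambda_i}$ for some $n\in\mathbb{N}^+$ and $\lambda_1,\dots,\lambda_n\in\Lambda$; $L$ is compactly generated if every element of $L$ is a join of compact elements. An element $m\neq 1$ is maximal if $m\leqslant x$ and $x<1$ imply $m=x$, for all $x\in L$; $\mathcal{M}(L)$ is the set of maximal elements. For $a\in L$ put $\mathcal{M}_a=\{m\in\mathcal{M}(L)\mid a\leqslant m\}$ and $\mathsf{m}_a=\bigwedge\mathcal{M}_a$ (the empty meet is $1$). An element $x\in L$ is a $z$-element if for all $a,b\in L$, $\mathcal{M}_a=\mathcal{M}_b$ and $b\leqslant x$ imply $a\leqslant x$. $L$ is a $szi$-multiplicative lattice if $(\mathsf{m}_a)^2=\mathsf{m}_a$ for every $a\in L$. An element $r\in L$ is primary if for all $x,y\in L$, $xy\leqslant r$ implies $x\leqslant r$ or $y^n\leqslant r$ for some $n\in\mathbb{N}^+$. An element $r$ is $z$-primary if $r$ is a $z$-element and for all $z$-elements $x,y$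 of $L$, $xy\leqslant r$ implies $x\leqslant r$ or $y^n\leqslant r$ for some $n\in\mathbb{N}^+$. *)

(* Defs.v *)
From HB Require Import structures.
From mathcomp Require Import all_boot all_order.
From mathcomp Require Import boolp classical_sets.

Set Implicit Arguments.
Unset Strict Implicit.
Unset Printing Implicit Defensive.

Import Order.Theory.

Local Open Scope classical_set_scope.
Local Open Scope order_scope.
Local Open Scope group_scope.

HB.mixin Record TBLattice_isComplete d L of Order.TBLattice d L := {
  supremums_neq0 : forall A : set L, supremums A !=set0
}.

#[short(type="completeLatticeType")]
HB.structure Definition CompleteLattice d :=
  { L of TBLattice_isComplete d L & Order.TBLattice d L }.

(* [supremum x0 set0] and [infimum x0 set0] are the default value [x0]:
   with these defaults the empty join is the bottom and the empty meet the top. *)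
Definition bigsup d (L : completeLatticeType d) (A : set L) : L :=
  supremum \bot A.

Definition biginf d (L : completeLatticeType d) (A : set L) : L :=
  infimum \top A.

HB.mixin Record CompleteLattice_Monoid_isMultLattice d L
    of CompleteLattice d L & Monoid L := {
  mult_comm : forall x y : L, x * y = y * x;
  mult_one_top : (1 : L) = \top;
  mult_bigsup : forall (x : L) (A : set L),
    x * bigsup A = bigsup [set x * y | y in A]
}.

#[short(type="multLatticeType")]
HB.structure Definition MultLattice d :=
  { L of CompleteLattice_Monoid_isMultLattice d L &
         CompleteLattice d L & Monoid L }.

Section MultLatticeDefs.
Context {d : Order.disp_t} {L : multLatticeType d}.
Implicit Types (a b c m r x y : L) (A : set L).

(* Finite subfamilies have at least one member, so only nonempty families can
   be considered; otherwise the bottom element would never be compact. *)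
Definition compact_elt c : Prop :=
  forall A, A !=set0 -> c <= bigsup A ->
  exists n (x : 'I_n.+1 -> L),
    (forall i, A (x i)) /\ c <= \join_(i < n.+1) x i.

Definition maximal_elt m : Prop :=
  m <> \top /\ forall x, m <= x -> x < \top -> m = x.

Definition max_above a : set L := [set m | maximal_elt m /\ a <= m].

Definition max_meet a : L := biginf (max_above a).

Definition z_elt x : Prop :=
  forall a b, max_above a = max_above b -> b <= x -> a <= x.

Definition primary_elt r : Prop :=
  forall x y, x * y <= r -> x <= r \/ exists2 n, (0 < n)%N & y ^+ n <= r.

Definition z_primary_elt r : Prop :=
  z_elt r /\
  forall x y, z_elt x -> z_elt y ->
    x * y <= r -> x <= r \/ exists2 n, (0 < n)%N & y ^+ n <= r.

End MultLatticeDefs.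

Definition compactly_generated d (L : multLatticeType d) : Prop :=
  forall x : L, exists2 A : set L,
    (forall c, A c -> compact_elt c) & x = bigsup A.

Definition szi_lattice d (L : multLatticeType d) : Prop :=
  forall a : L, max_meet a ^+ 2 = max_meet a.

(* Main.v *)
(** Every maximal element is prime, so max_meet x * max_meet y <= max_meet (x * y).
    Moreover max_meet a is the least z-element above a.  Hence x * y <= r with r a
    z-element gives max_meet x * max_meet y <= r, a product of two z-elements. *)

Require Import Defs.
From mathcomp Require Import all_boot all_order.
From mathcomp Require Import boolp classical_sets.

Import Order.TTheory.

Section CompleteLattice.
Local Set Implicit Arguments.
Local Unset Strict Implicit.
Local Open Scope order_scope.
Context {d : Order.disp_t} {L : completeLatticeType d}.
Implicit Types (x y : L) (A : set L).

Lemma bigsup_supremums A : supremums A (bigsup A).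
Proof.
rewrite /bigsup /supremum; case: ifPn => [/eqP -> | _].
  by split=> [x []|x _]; exact: le0x.
by case: (supremums_neq0 A) => x Ax; exact: (xgetPex _ (ex_intro _ x Ax)).
Qed.

Lemma bigsup_le A x : (bigsup A <= x) <-> (forall y, A y -> y <= x).
Proof.
have [Aub lub] := bigsup_supremums A; split; last exact: lub.
by move=> sx y /Aub ysup; exact: le_trans ysup sx.
Qed.

(** Completeness is postulated for joins only, so the meet is obtained as the join of all lower
    bounds: each element of [A] bounds [lbound A] from above, hence lies above that join. *)
Lemma biginf_infimums A : infimums A (biginf A).
Proof.
rewrite /biginf /infimum; case: ifPn => [/eqP -> | _].
  by split=> [x []|x _]; exact: lex1.
have [ubi lbi] := bigsup_supremums (lbound A).
have infA : infimums A (bigsup (lbound A)).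
  split; last exact: ubi.
  by move=> a Aa; apply: lbi => b; exact.
exact: (xgetPex _ (ex_intro _ _ infA)).
Qed.

Lemma le_biginf A x : (x <= biginf A) <-> (forall y, A y -> x <= y).
Proof.
have [Alb glb] := biginf_infimums A; split; last exact: glb.
by move=> xi y /Alb; exact: le_trans xi.
Qed.

(** Transfers distributivity from arbitrary joins to the binary join of the lattice. *)
Lemma bigsup2 x y : bigsup [set x; y]%classic = Order.join x y.
Proof.
apply/le_anti/andP; split.
  by apply/bigsup_le => z [] ->; rewrite (leUl, leUr).
have le_sup := (bigsup_le [set x; y]%classic _).1 (lexx _).
by rewrite leUx !le_sup //; [right|left].
Qed.

End CompleteLattice.

Section MultLattice.
Local Set Implicit Arguments.
Local Unset Strict Implicit.
Local Open Scope group_scope.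
Local Open Scope order_scope.
Context {d : Order.disp_t} {L : multLatticeType d}.
Implicit Types (a b m r x y z : L).

Lemma mult_joinr x y z :
  x * Order.join y z = Order.join (x * y) (x * z) :> L.
Proof. by rewrite -!bigsup2 mult_bigsup image_setU !image_set1. Qed.

Lemma mult_le2l x y z : y <= z -> x * y <= x * z.
Proof. by move=> /join_idPl yz; rewrite -yz mult_joinr leUr. Qed.

Lemma mult_le2 x y z t : x <= y -> z <= t -> x * z <= y * t.
Proof.
move=> xy zt; apply: (le_trans (mult_le2l x zt)).
by rewrite ![_ * t]mult_comm; exact: mult_le2l.
Qed.

Lemma mult_lel x y : x * y <= x.
Proof. by rewrite -[leRHS]mulg1 mult_one_top; apply/mult_le2l/lex1. Qed.

Lemma mult_ler x y : x * y <= y.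
Proof. by rewrite mult_comm mult_lel. Qed.

Lemma exp_le2 x y n : x <= y -> x ^+ n <= y ^+ n.
Proof.
move=> xy; elim: n => [|n IHn]; first by rewrite !expg0.
by rewrite !expgS; exact: mult_le2.
Qed.

Lemma maximal_join m x : maximal_elt m -> ~ x <= m -> Order.join x m = \top.
Proof.
move=> [_ mmax] xm; apply: contrapT => /eqP; rewrite -ltx1 => xm1.
by apply: xm; rewrite (mmax _ (leUr m x) xm1) leUl.
Qed.

(** If [x] is not below [m], then [x] and [m] join to the top, which is the unit; so [y] is the join
    of [y * x] and [y * m], both below [m]. *)
Lemma maximal_prime m x y :
  maximal_elt m -> x * y <= m -> x <= m \/ y <= m.
Proof.
move=> mmax xym; have [xm|/(maximal_join mmax) xm1] := pselect (x <= m).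
  by left.
right; rewrite -[leLHS]mulg1 mult_one_top -xm1 mult_joinr leUx mult_ler andbT.
by rewrite mult_comm.
Qed.

Lemma le_max_meet a : a <= max_meet a.
Proof. by apply/le_biginf => m []. Qed.

Lemma max_meet_le a m : max_above a m -> max_meet a <= m.
Proof. exact: (le_biginf _ _).1. Qed.

Lemma max_above_max_meet a : max_above (max_meet a) = max_above a.
Proof.
apply/seteqP; split=> m [mmax am]; split=> //.
  exact: le_trans (le_max_meet a) am.
exact: max_meet_le.
Qed.

(** A maximal element above [a] is above [max_meet a], hence above any [c] below it; equality of the
    two families then puts it above [b]. *)
Lemma max_meet_z a : z_elt (max_meet a).
Proof.
move=> b c Mbc ca; apply/le_biginf => m am.
have [] // : max_above b m.
by rewrite Mbc; split; [case: am|exact: le_trans ca (max_meet_le am)].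
Qed.

(** The z-condition applies to the pair [max_meet a], [a], since both lie below the same maximal
    elements. *)
Lemma z_max_meet_le r a : z_elt r -> a <= r -> max_meet a <= r.
Proof. by move=> rz; apply: rz; exact: max_above_max_meet. Qed.

Lemma max_meet_mult x y : max_meet x * max_meet y <= max_meet (x * y).
Proof.
apply/le_biginf => m [mmax /(maximal_prime mmax)[xm|ym]].
- by apply: le_trans (mult_lel _ _) _; exact: max_meet_le.
- by apply: le_trans (mult_ler _ _) _; exact: max_meet_le.
Qed.

Lemma z_primary_primary r : z_primary_elt r -> primary_elt r.
Proof.
move=> [rz rprim] x y xyr.
have [xr|[n n_gt0 yr]] := rprim _ _ (@max_meet_z x) (@max_meet_z y)
  (le_trans (max_meet_mult x y) (z_max_meet_le rz xyr)).
  (* Either alternative descends from [max_meet x], [max_meet y] to the smaller [x], [y], powers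
     being monotone. *)
  by left; exact: le_trans (le_max_meet x) xr.
right; exists n => //.
exact: le_trans (exp_le2 n (le_max_meet y)) yr.
Qed.

End MultLattice.

Theorem proposition5p11 (d : Order.disp_t) (L : multLatticeType d)
    (L_compactly_generated : compactly_generated L)
    (top_compact : compact_elt (\top%O : L))
    (prod_compact : forall (n : nat) (c : 'I_n -> L),
      (forall i, compact_elt (c i)) -> compact_elt (\prod_(i < n) c i)%g)
    (L_szi : szi_lattice L) (r : L) :
  z_primary_elt r <-> z_elt r /\ primary_elt r.
Proof.
split=> [rzp|[rz rprim]]; first by split; [case: rzp|exact: z_primary_primary].
(* Conversely, z-primariness restricts the primary condition to z-elements. *)
by split=> // x y _ _; exact: rprim.
Qed.
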